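(* Let $(A_{\mathrm{AdS}}(\rho),\phi(\rho))$ be a proper domain wall solution of AdS$_3$-Einstein-dilaton gravity. Then there is a corresponding proper flat-space domain wall solution $(A(r),\phi(r))$ with the following properties: (I) In the UV ($r\to\infty$), the flat space asymptotic symmetries generate a $\mathfrak{bms}_3$ algebra with central charge $c_{\mathrm M}^{\mathrm{UV}}=\frac{3}{G_N}$. (II) In the IR ($r\to-\infty$), the flat space asymptotic symmetries generate a $\mathfrak{bms}_3$ algebra with a central charge $c_{\mathrm M}^{\mathrm{IR}}$ that in general differs from $c_{\mathrm M}^{\mathrm{UV}}$.
   Context: **Equations of motion.** For a 3d Lorentzian metric $g$, a real scalar $\phi$ and a potential $V$ (action $\frac{1}{16\pi G_N}\int d^3x\sqrt{-g}\,(R-\frac12(\partial\phi)^2-V(\phi))$, Newton constant $G_N>0$): $$R_{\mu\nu}-\tfrac12 g_{\mu\nu}R=\tfrac12\partial_\mu\phi\,\partial_\nu\phi-\tfrac14(\partial\phi)^2g_{\mu\nu}-\tfrac12V(\phi)g_{\mu\nu},\qquad \nabla^2\phi=V'(\phi).$$ **Proper AdS$_3$ domain wall.** A proper domain wall solution of AdS$_3$-Einstein-dilaton gravity is an exact solution of these equations, with some potential of the form $V(\phi)=-2+\frac12m^2\phi^2+\dots$ (higher powers of $\phi$), with metric $ds^2=d\rho^2+e^{2A_{\mathrm{AdS}}(\rho)}(-dt^2+dx^2)$ and $\phi=\phi(\rho)$, $\rho\in\mathbb R$, such that: 1. for $\rho\to\infty$ the metric asymptotes to Poincaré patch AdS$_3$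 with unit AdS radius, i.e. $A_{\mathrm{AdS}}(\rho)=\rho+\mathrm{const}+o(1)$, and $\phi\to0$; 2. for $\rho\to-\infty$ the metric asymptotes to Poincaré patch AdS$_3$ with AdS radius $\ell_{\mathrm{IR}}$ smaller than one, i.e. $A_{\mathrm{AdS}}(\rho)=\rho/\ell_{\mathrm{IR}}+\mathrm{const}+o(1)$, and $\phi$ approaches a constant (possibly zero); 3. for finite $\rho$ the functions $A_{\mathrm{AdS}}$ and $\phi$ are bounded and real; $A_{\mathrm{AdS}}$ is at least $C^2$ and $\phi$ at least $C^1$. **Proper flat-space domain wall.** A proper flat-space domain wall solution is an exact solution of the same equations with $V=0$, with metric $ds^2=-2e^{A(r)}\,du\,dr+e^{2A(r)}\,d\varphi^2$ and $\phi=\phi(r)$, $r\in\mathbb R$, such that: 1. for $r\to\infty$ the metric asymptotes to the null orbifold $-2\,du\,d\varrho+\varrho^2d\varphi^2$ (with $\varrho=e^{r-r_0}$), i.e. $A(r)=r-r_0+o(1)$ for some constant $r_0$, and $\phi\to0$; 2. for $r\to-\infty$ the metric asymptotes to the null orbifold with a possibly rescaled first term, $-2\lambda\,du\,d\varrho+\varrho^2d\varphi^2$ with some $\lambda>0$ (with $\varrho=e^{(r-r_1)/\lambda}$), i.e. $A(r)=\lambda^{-1}(r-r_1)+o(1)$ for some constant $r_1$, and $\phi$ approaches a constant (possibly zero); 3. for finite $r$ the functions $A$ and $\phi$ are bounded and real; $A$ is at least $C^2$ and $\phi$ at least $C^1$. **Correspondence.** The flat-space domain wall corresponding to a given AdS$_3$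 domain wall is one whose scalar field $\phi(r)$ is the same function as the AdS$_3$ scalar field $\phi(\rho)$, with $\rho$ renamed $r$. **$\mathfrak{bms}_3$ central charge.** $\mathfrak{bms}_3$ has generators $L_n,M_n$ ($n\in\mathbb Z$) with $[L_n,L_m]=(n-m)L_{n+m}+\frac{c_{\mathrm L}}{12}n(n^2-1)\delta_{n+m,0}$, $[L_n,M_m]=(n-m)M_{n+m}+\frac{c_{\mathrm M}}{12}n(n^2-1)\delta_{n+m,0}$, $[M_n,M_m]=0$. In an asymptotic region where the metric asymptotes to $-2\,du\,d\varrho+\varrho^2d\varphi^2$, the asymptotic symmetry algebra is $\mathfrak{bms}_3$ with $c_{\mathrm L}=0$ and $c_{\mathrm M}=3/G_N$ (Barnich–Compère boundary conditions, standard normalization of $M_n$); where it asymptotes to $-2\lambda\,du\,d\varrho+\varrho^2d\varphi^2$, with generators normalized in the same way, it is $\mathfrak{bms}_3$ with $c_{\mathrm L}=0$ and $c_{\mathrm M}=3\lambda/G_N$. These facts define $c_{\mathrm M}^{\mathrm{UV}}$ (region $r\to\infty$) and $c_{\mathrm M}^{\mathrm{IR}}$ (region $r\to-\infty$). *)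

(* Defs.v *)
From HB Require Import structures.
From mathcomp Require Import all_boot all_order all_algebra.
From mathcomp Require Import all_classical all_reals all_analysis.

Set Implicit Arguments.
Unset Strict Implicit.
Unset Printing Implicit Defensive.

Import Order.TTheory GRing.Theory Num.Theory.
Import numFieldNormedType.Exports.

Local Open Scope classical_set_scope.
Local Open Scope ring_scope.

Section Geometry.
Variable R : realType.

(* Points of the coordinate chart R^3 are row vectors; a metric is its matrix
   of components as a function of the point. *)
Notation point := 'rV[R]_3.
Notation metric := ('rV[R]_3 -> 'M[R]_3).

Definition partial (mu : 'I_3) (f : point -> R) (x : point) : R :=
  'D_('e_mu) f x.

Definition inv_metric (g : metric) (x : point) : 'M[R]_3 := invmx (g x).

(* Gamma^k_{ij} *)
Definition christoffel (g : metric) (k i j : 'I_3) (x : point) : R :=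
  2^-1 * \sum_(l < 3) inv_metric g x k l *
    (partial i (fun y => g y l j) x + partial j (fun y => g y l i) x
     - partial l (fun y => g y i j) x).

(* R_{ij} = d_k Gamma^k_{ij} - d_j Gamma^k_{ik}
            + Gamma^k_{kl} Gamma^l_{ij} - Gamma^k_{jl} Gamma^l_{ik} *)
Definition ricci (g : metric) (i j : 'I_3) (x : point) : R :=
  \sum_(k < 3) (partial k (christoffel g k i j) x
                - partial j (christoffel g k i k) x)
  + \sum_(k < 3) \sum_(l < 3)
      (christoffel g k k l x * christoffel g l i j x
       - christoffel g k j l x * christoffel g l i k x).

Definition scalar_curvature (g : metric) (x : point) : R :=
  \sum_(i < 3) \sum_(j < 3) inv_metric g x i j * ricci g i j x.

(* (d Phi)^2 *)
Definition grad_sq (g : metric) (Phi : point -> R) (x : point) : R :=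
  \sum_(i < 3) \sum_(j < 3)
    inv_metric g x i j * partial i Phi x * partial j Phi x.

(* nabla^mu Phi = g^{mu nu} d_nu Phi *)
Definition gradient (g : metric) (Phi : point -> R) (mu : 'I_3) (x : point) : R :=
  \sum_(nu < 3) inv_metric g x mu nu * partial nu Phi x.

(* nabla_mu J^mu = d_mu J^mu + Gamma^mu_{mu nu} J^nu *)
Definition divergence (g : metric) (J : 'I_3 -> point -> R) (x : point) : R :=
  \sum_(mu < 3) (partial mu (J mu) x
    + \sum_(nu < 3) christoffel g mu mu nu x * J nu x).

Definition laplacian (g : metric) (Phi : point -> R) (x : point) : R :=
  divergence g (gradient g Phi) x.

Definition einstein_eq (V : R -> R) (g : metric) (Phi : point -> R) : Prop :=
  forall (mu nu : 'I_3) (x : point),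
    ricci g mu nu x - 2^-1 * g x mu nu * scalar_curvature g x
    = 2^-1 * partial mu Phi x * partial nu Phi x
      - 4^-1 * grad_sq g Phi x * g x mu nu
      - 2^-1 * V (Phi x) * g x mu nu.

(* 'D_v is total, so the differentiability of nabla^mu Phi needed for the
   scalar equation to be meaningful is required explicitly. Phi is not assumed
   twice differentiable: for a null profile Phi(r), g^{rr} = 0, no second
   derivative of Phi enters. *)
Definition scalar_eq (V : R -> R) (g : metric) (Phi : point -> R) : Prop :=
  (forall (mu : 'I_3) (x : point),
     derivable (gradient g Phi mu) x 'e_mu) /\
  (forall x : point, laplacian g Phi x = derive1 V (Phi x)).

Definition field_eqs (V : R -> R) (g : metric) (Phi : point -> R) : Prop :=
  einstein_eq V g Phi /\ scalar_eq V g Phi.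

(* The radial coordinate is the coordinate of index 0 in both ansaetze. *)
Definition radial (x : point) : R := x 0 0.

Definition mx3 (rows : seq (seq R)) : 'M[R]_3 :=
  \matrix_(i < 3, j < 3) (nth [::] rows i)`_j.

(* d rho^2 + e^{2A(rho)} (- dt^2 + dx^2), coordinates (rho, t, x) *)
Definition ads_metric (A : R -> R) : metric := fun x =>
  mx3 [:: [:: 1; 0; 0];
          [:: 0; - expR (2 * A (radial x)); 0];
          [:: 0; 0; expR (2 * A (radial x))]].

(* - 2 e^{A(r)} du dr + e^{2A(r)} dvarphi^2, coordinates (r, u, varphi) *)
Definition flat_metric (A : R -> R) : metric := fun x =>
  mx3 [:: [:: 0; - expR (A (radial x)); 0];
          [:: - expR (A (radial x)); 0; 0];
          [:: 0; 0; expR (2 * A (radial x))]].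

End Geometry.

Section DomainWalls.
Variable R : realType.

Definition C1 (f : R -> R) : Prop :=
  (forall x, derivable f x 1) /\ continuous (derive1 f).

Definition C2 (f : R -> R) : Prop :=
  (forall x, derivable f x 1) /\ C1 (derive1 f).

(* V(y) = -2 + m^2 y^2 / 2 + o(y^2) at y = 0; m^2 is a real number of either
   sign. Differentiability of V is what V'(phi) requires. *)
Definition ads_potential (V : R -> R) : Prop :=
  (forall y, derivable V y 1) /\
  V 0 = - 2 /\
  exists msq : R,
    (V y - (- 2 + 2^-1 * msq * y ^+ 2)) / y ^+ 2 @[y --> 0^'] --> (0 : R).

(* A and phi are real-valued on all of R and continuous, which makes them
   bounded at finite radial coordinate. *)
Definition proper_ads_wall (A phi : R -> R) : Prop :=
  (exists V : R -> R, ads_potential V /\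
     field_eqs V (ads_metric A) (fun x => phi (radial x))) /\
  ((exists c : R, A rho - rho @[rho --> +oo] --> c) /\
   phi rho @[rho --> +oo] --> (0 : R)) /\
  (exists l : R, 0 < l < 1 /\
     exists c : R, A rho - rho / l @[rho --> -oo] --> c) /\
  (exists phi0 : R, phi rho @[rho --> -oo] --> phi0) /\
  C2 A /\ C1 phi.

(* In the region described by F, the metric flat_metric A asymptotes to
   - 2 lam du dvarrho + varrho^2 dvarphi^2 with varrho = e^{(r - r0) / lam}. *)
Definition asymptotes_null_orbifold
    (F : set_system R) (A : R -> R) (lam : R) : Prop :=
  0 < lam /\
  exists r0 : R, A r - (r - r0) / lam @[r --> F] --> (0 : R).

Definition proper_flat_wall (A phi : R -> R) : Prop :=
  field_eqs (fun _ => 0) (flat_metric A) (fun x => phi (radial x)) /\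
  (asymptotes_null_orbifold +oo A 1 /\ phi r @[r --> +oo] --> (0 : R)) /\
  (exists lam : R, asymptotes_null_orbifold -oo A lam) /\
  (exists phi0 : R, phi r @[r --> -oo] --> phi0) /\
  C2 A /\ C1 phi.

End DomainWalls.

Section CentralCharge.
Variable R : realType.

(* Basis of the centrally extended algebra; gen1 is the central element. *)
Inductive bms3_gen : Type :=
  | genL of int
  | genM of int
  | gen1.

(* Formal linear combinations of generators are coefficient functions. *)
Definition bms3_basis (a : bms3_gen) : bms3_gen -> R := fun b => `[< b = a >]%:R.

(* (c / 12) n (n^2 - 1) delta_{n+m,0} *)
Definition bms3_cocycle (c : R) (n m : int) : R :=
  c / 12 * (n * (n ^+ 2 - 1))%:~R * (n + m == 0)%:R.

(* The bracket of two generators of bms_3 with central charges cL and cM. *)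
Definition bms3_bracket (cL cM : R) (a b : bms3_gen) : bms3_gen -> R := fun d =>
  match a, b with
  | genL n, genL m =>
      (n - m)%:~R * bms3_basis (genL (n + m)) d
      + bms3_cocycle cL n m * bms3_basis gen1 d
  | genL n, genM m =>
      (n - m)%:~R * bms3_basis (genM (n + m)) d
      + bms3_cocycle cM n m * bms3_basis gen1 d
  | genM n, genL m =>
      - ((m - n)%:~R * bms3_basis (genM (m + n)) d
         + bms3_cocycle cM m n * bms3_basis gen1 d)
  | _, _ => 0
  end.

(* Brackets of the asymptotic symmetry generators, in the fixed normalization
   of M_n, for the asymptotics - 2 lam du dvarrho + varrho^2 dvarphi^2: the
   Barnich-Compere algebra, taken as the definition. *)
Definition asymptotic_bracket (GN lam : R) : bms3_gen -> bms3_gen -> bms3_gen -> R :=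
  bms3_bracket 0 (3 * lam / GN).

(* In the region F, the asymptotic symmetries of flat_metric A generate bms_3
   with central charges cL and cM. *)
Definition asymptotic_bms3 (GN : R) (F : set_system R) (A : R -> R)
    (cL cM : R) : Prop :=
  exists lam : R, asymptotes_null_orbifold F A lam /\
    forall a b d, asymptotic_bracket GN lam a b d = bms3_bracket cL cM a b d.

End CentralCharge.

(* Main.v *)
(** For the AdS3 wall the Einstein equations reduce to a Friedmann-type
    constraint and A'' = - phi'^2 / 2; for the flat wall they reduce to that
    second equation alone, and the scalar equation is void because
    g^{rr} = 0.  So the AdS profile A is itself a flat wall with the same phi:
    the linear term left free by A'' is fixed by the UV condition.  The IR
    asymptotics A = r / l + O(1) then say lambda = l < 1, hence
    c_M^IR = 3 l / G_N differs from 3 / G_N.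

    AdS walls are produced by a superpotential W: the gradient flow A' = W(phi),
    phi' = - 2 W'(phi) solves the field equations with V = 2 W'^2 - 2 W^2.  For
    a cubic W with critical points 0 and 1 the flow is logistic. *)

Require Import Defs.
From mathcomp Require Import all_boot all_order all_algebra.
From mathcomp Require Import all_classical all_reals all_analysis.
From mathcomp Require Import ring lra.
Import Order.TTheory GRing.Theory Num.Theory.
Import numFieldNormedType.Exports.

Set Implicit Arguments.
Unset Strict Implicit.
Unset Printing Implicit Defensive.

Local Open Scope classical_set_scope.
Local Open Scope ring_scope.

(** * Radial derivatives and Christoffel symbols of metrics that depend on one coordinate *)

Section RadialCurvature.
Context {R : realType}.
Implicit Types (A phi h V : R -> R) (G : R -> 'M[R]_3) (x : 'rV[R]_3).

(* No differentiability of h is needed: both sides are the same total limit. *)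
Lemma partial_radial (mu : 'I_3) h x :
  partial mu (fun y => h (radial y)) x = (mu == 0)%:R * derive1 h (radial x).
Proof.
rewrite /partial derive1E /derive.
have [->|mu0] := eqVneq mu 0.
  rewrite mul1r.
  suff -> : (fun t : R => t^-1 *: (h (radial (t *: 'e_0 + x)) - h (radial x)))
      = (fun t : R => t^-1 *: (h (t *: 1 + radial x) - h (radial x))) by [].
  by apply/funext => t; rewrite /radial !mxE eqxx.
rewrite mul0r.
have -> : (fun t : R => t^-1 *: (h (radial (t *: 'e_mu + x)) - h (radial x)))
    = cst 0.
  by apply/funext => t; rewrite /radial !mxE (eq_sym 0 mu) (negbTE mu0) andbF
    mulr0 add0r subrr scaler0.
by rewrite lim_cst.
Qed.

(** Off the radial direction the difference quotient is identically zero, hence the conditional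
    hypothesis. This matters in [scalar_flat], where the u component of the gradient contains a
    [phi'] that may be merely continuous. *)
Lemma derivable_radial (mu : 'I_3) h x :
  (mu = 0 -> derivable h (radial x) 1) ->
  derivable (fun y => h (radial y)) x 'e_mu.
Proof.
rewrite /derivable; have [->|mu0 _] := eqVneq mu 0.
  move/(_ erefl).
  suff -> : (fun t : R => t^-1 *: (h (t *: 1 + radial x) - h (radial x))) =
      (fun t : R => t^-1 *: (h (radial (t *: 'e_0 + x)) - h (radial x))) by [].
  by apply/funext => t; rewrite /radial !mxE eqxx.
have -> : (fun t : R => t^-1 *: (h (radial (t *: 'e_mu + x)) - h (radial x)))
    = cst 0.
  by apply/funext => t; rewrite /radial !mxE (eq_sym 0 mu) (negbTE mu0) andbF
    mulr0 add0r subrr scaler0.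
exact: is_cvg_cst.
Qed.

(** Indices are put in the form [inord k], so that [inordK] turns them into numerals and the
    component tables below compute. *)
Lemma sum3 (F : 'I_3 -> R) :
  \sum_(i < 3) F i = F (inord 0) + F (inord 1) + F (inord 2).
Proof.
rewrite !big_ord_recl big_ord0 addr0 addrA.
by congr (F _ + F _ + F _); apply/val_inj; rewrite /= inordK.
Qed.

Lemma ord3P (P : 'I_3 -> Prop) :
  P (inord 0) -> P (inord 1) -> P (inord 2) -> forall i, P i.
Proof.
move=> P0 P1 P2 i; rewrite -(inord_val i).
by case: i => [[|[|[|]]]].
Qed.

Lemma invmx_eq n (M N : 'M[R]_n) : M *m N = 1%:M -> invmx M = N.
Proof.
move=> MN; have [uM _] := mulmx1_unit MN.
by rewrite -[N](mulKmx uM) MN mulmx1.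
Qed.

Lemma inord3_eq0 :
  ((inord 0 == 0 :> 'I_3) = true) * ((inord 1 == 0 :> 'I_3) = false) *
  ((inord 2 == 0 :> 'I_3) = false).
Proof. by rewrite -!val_eqE /= !inordK. Qed.

(* Missing entries read as 0: the tables below omit trailing zeros. *)
Definition entry (s : seq (seq R)) (i j : nat) : R := nth 0 (nth [::] s i) j.

Lemma mx3E (s : seq (seq R)) i j : (i < 3)%N -> (j < 3)%N ->
  mx3 s (inord i) (inord j) = nth 0 (nth [::] s i) j.
Proof. by move=> i3 j3; rewrite mxE !inordK. Qed.

Lemma is_derive_derive1 h (r : R) :
  derivable h r 1 -> is_derive r 1 h (derive1 h r).
Proof. by move=> dh; rewrite derive1E; exact: derivableP. Qed.

Lemma is_derive_expRM (a : R) A r : derivable A r 1 ->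
  is_derive r 1 (fun r => expR (a * A r)) (a * derive1 A r * expR (a * A r)).
Proof.
move=> /is_derive_derive1 dA.
have d : is_derive r 1 (fun r => a * A r) (a * derive1 A r).
  exact: is_deriveZ.
have := @is_derive1_comp _ expR (fun r => a * A r) r _ _ (is_derive_expR _) d.
by rewrite mulrC.
Qed.

Lemma derive1P h (r d : R) : is_derive r 1 h d -> derive1 h r = d.
Proof. by rewrite derive1E; case. Qed.

Lemma christoffel_radial G (k i j : 'I_3) x :
  christoffel (fun y => G (radial y)) k i j x =
  2^-1 * \sum_(l < 3) invmx (G (radial x)) k l *
    ((i == 0)%:R * derive1 (fun r => G r l j) (radial x)
     + (j == 0)%:R * derive1 (fun r => G r l i) (radial x)
     - (l == 0)%:R * derive1 (fun r => G r i j) (radial x)).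
Proof.
rewrite /christoffel; congr (_ * _); apply: eq_bigr => l _.
by congr (_ * (_ + _ - _)); exact: partial_radial.
Qed.

(* ads_chr A k i j is Gamma^k_{ij}, indexed by natural numbers below 3. *)
Definition ads_chr A (k i j : nat) (r : R) : R :=
  match k, i, j with
  | 0%N, 1%N, 1%N => derive1 A r * expR (2 * A r)
  | 0%N, 2%N, 2%N => - (derive1 A r * expR (2 * A r))
  | 1%N, 0%N, 1%N | 1%N, 1%N, 0%N | 2%N, 0%N, 2%N | 2%N, 2%N, 0%N => derive1 A r
  | _, _, _ => 0
  end.

(** The analogous table in coordinates (r, u, varphi). Since g^{rr} = 0, the variation of e^{2A}
    feeds Gamma^u_{varphi varphi} instead of a symbol with upper index r. *)
Definition flat_chr A (k i j : nat) (r : R) : R :=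
  match k, i, j with
  | 0%N, 0%N, 0%N | 2%N, 0%N, 2%N | 2%N, 2%N, 0%N => derive1 A r
  | 1%N, 2%N, 2%N => derive1 A r * expR (A r)
  | _, _, _ => 0
  end.

Definition ads_rows (a : R) : seq (seq R) :=
  [:: [:: 1; 0; 0]; [:: 0; - a; 0]; [:: 0; 0; a]].

Definition flat_rows (a b : R) : seq (seq R) :=
  [:: [:: 0; - a; 0]; [:: - a; 0; 0]; [:: 0; 0; b]].

Lemma inv_ads (a : R) : a != 0 ->
  invmx (mx3 (ads_rows a)) = mx3 (ads_rows a^-1).
Proof.
move=> a0; apply: invmx_eq; apply/matrixP; apply: ord3P; apply: ord3P;
  rewrite !mxE sum3 !mxE !inordK //= -?val_eqE /= ?inordK //=; by field.
Qed.

Lemma inv_flat (a b : R) : a != 0 -> b != 0 ->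
  invmx (mx3 (flat_rows a b)) = mx3 (flat_rows a^-1 b^-1).
Proof.
move=> a0 b0; apply: invmx_eq; apply/matrixP; apply: ord3P; apply: ord3P;
  rewrite !mxE sum3 !mxE !inordK //= -?val_eqE /= ?inordK //=; by field.
Qed.

(** With tables [s'] for the radial derivative and [t] for the inverse, all 27 components become
    rational identities that [field] can close. *)
Lemma christoffel_mx3 (s : R -> seq (seq R)) (s' t : seq (seq R))
    (k i j : 'I_3) x :
  (forall l m : 'I_3,
     is_derive (radial x) 1 (fun r => entry (s r) l m) (entry s' l m)) ->
  invmx (mx3 (s (radial x))) = mx3 t ->
  christoffel (fun y => mx3 (s (radial y))) k i j x =
  2^-1 * \sum_(l < 3) entry t k l *
    ((i == 0)%:R * entry s' l j + (j == 0)%:R * entry s' l i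
     - (l == 0)%:R * entry s' i j).
Proof.
move=> sD sV; rewrite (christoffel_radial (fun r => mx3 (s r))) sV.
have dE (l m : 'I_3) :
    derive1 (fun r => mx3 (s r) l m) (radial x) = entry s' l m.
  rewrite -(derive1P (sD l m)); congr (derive1 _ _).
  by apply/funext => r; rewrite mxE.
by congr (_ * _); apply: eq_bigr => l _; rewrite !dE mxE.
Qed.

Lemma christoffel_ads A (k i j : 'I_3) x : (forall r, derivable A r 1) ->
  christoffel (ads_metric A) k i j x = ads_chr A k i j (radial x).
Proof.
move=> dA.
set r := radial x; have e0 := lt0r_neq0 (expR_gt0 (2 * A r)).
have dE := is_derive_expRM 2 (dA r).
pose s' := [:: [::]; [:: 0; - (2 * derive1 A r * expR (2 * A r))];
  [:: 0; 0; 2 * derive1 A r * expR (2 * A r)]].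
have sD (l m : 'I_3) : is_derive r 1
    (fun r => entry (ads_rows (expR (2 * A r))) l m) (entry s' l m).
  by move: l m; apply: ord3P; apply: ord3P; rewrite /entry !inordK //=;
    do ?[exact: is_derive_cst | exact: is_deriveN | exact: dE].
rewrite (christoffel_mx3 (s := fun r => ads_rows (expR (2 * A r)))
  _ _ _ sD (inv_ads e0)) /s'.
rewrite sum3; move: k i j; apply: ord3P; apply: ord3P; apply: ord3P;
  rewrite /entry !inord3_eq0 !inordK //=; by field.
Qed.

Lemma christoffel_flat A (k i j : 'I_3) x : (forall r, derivable A r 1) ->
  christoffel (flat_metric A) k i j x = flat_chr A k i j (radial x).
Proof.
move=> dA.
set r := radial x; have e0 := lt0r_neq0 (expR_gt0 (A r)).
have dE := is_derive_expRM 2 (dA r).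
have dE1 : is_derive r 1 (fun r => expR (A r)) (derive1 A r * expR (A r)).
  by rewrite mulrC; apply: is_derive1_comp; exact: is_derive_derive1.
pose s' := [:: [:: 0; - (derive1 A r * expR (A r))]; [:: - (derive1 A r * expR (A r))];
  [:: 0; 0; 2 * derive1 A r * expR (2 * A r)]].
have sD (l m : 'I_3) : is_derive r 1
    (fun r => entry (flat_rows (expR (A r)) (expR (2 * A r))) l m) (entry s' l m).
  by move: l m; apply: ord3P; apply: ord3P; rewrite /entry !inordK //=;
    do ?[exact: is_derive_cst | exact: is_deriveN | exact: dE | exact: dE1].
have e2 := lt0r_neq0 (expR_gt0 (2 * A r)).
rewrite (christoffel_mx3 (s := fun r => flat_rows (expR (A r)) (expR (2 * A r)))
  _ _ _ sD (inv_flat e0 e2)) /s'.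
(* The two exponentials were independent symbols so far; Gamma^u_{varphi varphi} needs e^{-A} e^{2A}
   = e^A. *)
have -> : expR (2 * A r) = expR (A r) ^+ 2 by rewrite mulrC expRM_natr.
rewrite sum3; move: k i j; apply: ord3P; apply: ord3P; apply: ord3P;
  rewrite /entry !inord3_eq0 !inordK //=; by field.
Qed.

Lemma ricci_radial (g : 'rV[R]_3 -> 'M[R]_3) (C : nat -> nat -> nat -> R -> R)
    (D : nat -> nat -> nat -> R) (i j : 'I_3) x :
  (forall (k i j : 'I_3) y, christoffel g k i j y = C k i j (radial y)) ->
  (forall k i j : 'I_3, is_derive (radial x) 1 (C k i j) (D k i j)) ->
  ricci g i j x =
  \sum_(k < 3) ((k == 0)%:R * D k i j - (j == 0)%:R * D k i k)
  + \sum_(k < 3) \sum_(l < 3)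
      (C k k l (radial x) * C l i j (radial x)
       - C k j l (radial x) * C l i k (radial x)).
Proof.
move=> gC CD; rewrite /ricci; congr (_ + _); apply: eq_bigr => k _.
  have -> a b : christoffel g k a b = fun y => C k a b (radial y).
    by apply/funext => y; exact: gC.
  have -> : christoffel g k i k = fun y => C k i k (radial y).
    by apply/funext => y; exact: gC.
  by rewrite !partial_radial !(derive1P (CD _ _ _)).
by apply: eq_bigr => l _; rewrite !gC.
Qed.

Lemma gradient_radial (g : 'rV[R]_3 -> 'M[R]_3) phi (mu : 'I_3) x :
  gradient g (fun y => phi (radial y)) mu x =
  inv_metric g x mu (inord 0) * derive1 phi (radial x).
Proof.
rewrite /gradient sum3 !partial_radial !inord3_eq0.
by rewrite !mul0r !mulr0 !addr0 mul1r.
Qed.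

(** * Ricci tensors of the two ansaetze and reduction of the field equations to ODEs *)

Section ProfileC2.
Variable A : R -> R.
Hypothesis A2 : C2 A.

Let dA r : derivable A r 1. Proof. by have [] := A2. Qed.
Let dA1 r : derivable (derive1 A) r 1. Proof. by have [_ []] := A2. Qed.

Lemma ricci_ads (i j : 'I_3) x :
  ricci (ads_metric A) i j x =
  let a1 := derive1 A (radial x) in let a2 := derive1 (derive1 A) (radial x) in
  let e := expR (2 * A (radial x)) * (a2 + 2 * a1 ^+ 2) in
  entry [:: [:: - 2 * (a2 + a1 ^+ 2)]; [:: 0; e]; [:: 0; 0; - e]] i j.
Proof.
set r := radial x; set a1 := derive1 A r; set a2 := derive1 (derive1 A) r.
have dE := is_derive_expRM 2 (@dA r).
have d1 := is_derive_derive1 (@dA1 r).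
have dM := is_deriveM d1 dE.
pose m := derive1 A r * (2 * derive1 A r * expR (2 * A r)) + expR (2 * A r) * a2.
pose D (k i j : nat) : R := match k, i, j with
  | 0%N, 1%N, 1%N => m
  | 0%N, 2%N, 2%N => - m
  | 1%N, 0%N, 1%N | 1%N, 1%N, 0%N | 2%N, 0%N, 2%N | 2%N, 2%N, 0%N => a2
  | _, _, _ => 0
  end.
have CD (k l n : 'I_3) : is_derive r 1 (ads_chr A k l n) (D k l n).
  by move: k l n; apply: ord3P; apply: ord3P; apply: ord3P;
    rewrite !inordK //=;
    do ?[exact: is_derive_cst | exact: d1 | exact: dM | exact: is_deriveN].
rewrite (ricci_radial _ _ (fun k i j y => christoffel_ads k i j y dA) CD).
move: i j; apply: ord3P; apply: ord3P;
  rewrite !sum3 /entry !inord3_eq0 !inordK //= /m -/r -/a1; by ring.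
Qed.

(** In R_{rr} the trace Gamma^k_{kr} = 2 A' times Gamma^r_{rr} = A' cancels the quadratic term 2
    A'^2, so A enters only through A''. *)
Lemma ricci_flat (i j : 'I_3) x :
  ricci (flat_metric A) i j x =
  entry [:: [:: - derive1 (derive1 A) (radial x)]] i j.
Proof.
set r := radial x; set a2 := derive1 (derive1 A) r.
have dE : is_derive r 1 (fun r => expR (A r)) (expR (A r) * derive1 A r).
  by apply: is_derive1_comp; exact: is_derive_derive1.
have d1 := is_derive_derive1 (@dA1 r).
have dM := is_deriveM d1 dE.
pose m := derive1 A r * (expR (A r) * derive1 A r) + expR (A r) * a2.
pose D (k i j : nat) : R := match k, i, j with
  | 0%N, 0%N, 0%N | 2%N, 0%N, 2%N | 2%N, 2%N, 0%N => a2
  | 1%N, 2%N, 2%N => m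
  | _, _, _ => 0
  end.
have CD (k l n : 'I_3) : is_derive r 1 (flat_chr A k l n) (D k l n).
  by move: k l n; apply: ord3P; apply: ord3P; apply: ord3P;
    rewrite !inordK //=;
    do ?[exact: is_derive_cst | exact: d1 | exact: dM].
rewrite (ricci_radial _ _ (fun k i j y => christoffel_flat k i j y dA) CD).
move: i j; apply: ord3P; apply: ord3P;
  rewrite !sum3 /entry !inord3_eq0 !inordK //= /m -/r; by ring.
Qed.

Lemma contract_inv_ads (F : 'I_3 -> 'I_3 -> R) x :
  \sum_(i < 3) \sum_(j < 3) inv_metric (ads_metric A) x i j * F i j =
  F (inord 0) (inord 0)
  + (expR (2 * A (radial x)))^-1 * (F (inord 2) (inord 2) - F (inord 1) (inord 1)).
Proof.
rewrite /inv_metric inv_ads ?lt0r_neq0 ?expR_gt0// !sum3 !mx3E //=.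
rewrite !(mul0r, mulr0, add0r, addr0, mul1r) mulNr mulrBr -addrA; congr (_ + _).
exact: addrC.
Qed.

(** [F] is arbitrary so that one computation serves both the curvature scalar and (d phi)^2. The rr
    slot is absent, which makes both of these vanish. *)
Lemma contract_inv_flat (F : 'I_3 -> 'I_3 -> R) x :
  \sum_(i < 3) \sum_(j < 3) inv_metric (flat_metric A) x i j * F i j =
  - (expR (A (radial x)))^-1 * (F (inord 0) (inord 1) + F (inord 1) (inord 0))
  + (expR (2 * A (radial x)))^-1 * F (inord 2) (inord 2).
Proof.
rewrite /inv_metric inv_flat ?lt0r_neq0 ?expR_gt0// !sum3 !mx3E //=.
by rewrite !(mul0r, mulr0, add0r, addr0) mulrDr.
Qed.

Lemma scalar_curvature_ads x :
  scalar_curvature (ads_metric A) x =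
  - 4 * derive1 (derive1 A) (radial x) - 6 * derive1 A (radial x) ^+ 2.
Proof.
have e0 := lt0r_neq0 (expR_gt0 (2 * A (radial x))).
rewrite /scalar_curvature contract_inv_ads !ricci_ads /entry !inordK //=.
by field.
Qed.

Lemma scalar_curvature_flat x : scalar_curvature (flat_metric A) x = 0.
Proof.
rewrite /scalar_curvature contract_inv_flat !ricci_flat /entry !inordK //=.
by rewrite addr0 !mulr0 addr0.
Qed.

Lemma grad_sqE (g : 'rV[R]_3 -> 'M[R]_3) phi x :
  grad_sq g (fun y => phi (radial y)) x =
  \sum_(i < 3) \sum_(j < 3) inv_metric g x i j *
    ((i == 0)%:R * (j == 0)%:R * derive1 phi (radial x) ^+ 2).
Proof.
rewrite /grad_sq; apply: eq_bigr => i _; apply: eq_bigr => j _.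
by rewrite !partial_radial; ring.
Qed.

Lemma grad_sq_ads phi x :
  grad_sq (ads_metric A) (fun y => phi (radial y)) x = derive1 phi (radial x) ^+ 2.
Proof.
by rewrite grad_sqE contract_inv_ads !inord3_eq0 !mul0r subr0 mulr0 addr0 !mul1r.
Qed.

Lemma grad_sq_flat phi x :
  grad_sq (flat_metric A) (fun y => phi (radial y)) x = 0.
Proof.
by rewrite grad_sqE contract_inv_flat !inord3_eq0 mulr0 !mul0r addr0 !mulr0 addr0.
Qed.

(** The rho-rho component is the constraint, the xx component gives A'' + A'^2, and their difference
    is the A'' equation. The tt component is minus the xx one, and off-diagonal components vanish on
    both sides. *)
Lemma einstein_ads V phi :
  einstein_eq V (ads_metric A) (fun x => phi (radial x)) <->
  forall r, derive1 A r ^+ 2 = 4^-1 * derive1 phi r ^+ 2 - 2^-1 * V (phi r) /\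
    derive1 (derive1 A) r = - 2^-1 * derive1 phi r ^+ 2.
Proof.
split=> [H r|H mu nu x].
  (* The equations hold at points of the chart; a constant vector supplies one with radial
     coordinate [r]. *)
  have rx : radial (const_mx r : 'rV[R]_3) = r by rewrite /radial mxE.
  have := H (inord 0) (inord 0) (const_mx r); have := H (inord 2) (inord 2) (const_mx r).
  rewrite scalar_curvature_ads grad_sq_ads !ricci_ads !partial_radial rx !inord3_eq0.
  rewrite /ads_metric !mx3E // rx /entry !inordK //=.
  rewrite !(mul0r, mulr0, mul1r, mulr1, subr0).
  move: (lt0r_neq0 (expR_gt0 (2 * A r))); move: (expR _) => e e0 H2 H0.
  set a2 := derive1 (derive1 A) r in H0 H2 *; set a1 := derive1 A r in H0 H2 *.
  set p := derive1 phi r in H0 H2 *; set v := V _ in H0 H2 *.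
  have {}H2 : a2 + a1 ^+ 2 = - 4^-1 * p ^+ 2 - 2^-1 * v.
    apply: (mulfI e0); lra.
  split; lra.
have [] := H (radial x).
rewrite scalar_curvature_ads grad_sq_ads !ricci_ads !partial_radial.
move: (derive1 (derive1 A) _) (derive1 A _) (derive1 phi _) (V _) => a2 a1 p v.
rewrite /ads_metric; move: (expR _) => e H1 ->.
rewrite H1.
move: mu nu; apply: ord3P; apply: ord3P;
  rewrite !inord3_eq0 !mx3E // /entry !inordK //= !(mul0r, mulr0, mul1r, mulr1, subr0) //; by field.
Qed.

(** The curvature scalar, (d phi)^2 and the potential are all zero, so both sides live in the rr
    slot alone: - A'' = phi'^2 / 2. *)
Lemma einstein_flat phi :
  einstein_eq (fun _ => 0) (flat_metric A) (fun x => phi (radial x)) <->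
  forall r, derive1 (derive1 A) r = - 2^-1 * derive1 phi r ^+ 2.
Proof.
split=> [H r|H mu nu x].
  have rx : radial (const_mx r : 'rV[R]_3) = r by rewrite /radial mxE.
  have := H (inord 0) (inord 0) (const_mx r).
  rewrite scalar_curvature_flat grad_sq_flat !ricci_flat !partial_radial rx !inord3_eq0.
  rewrite /entry !inordK //= !(mul0r, mulr0, mul1r, mulr1, subr0) => ?; lra.
rewrite scalar_curvature_flat grad_sq_flat !ricci_flat !partial_radial H.
move: (derive1 phi _) => p.
move: mu nu; apply: ord3P; apply: ord3P;
  rewrite !inord3_eq0 /entry !inordK //= !(mul0r, mulr0, mul1r, mulr1, subr0) //; by field.
Qed.

(** The gradient has only the u component [j], a function of r: its u-derivative vanishes, and so
    does Gamma^mu_{mu u}. *)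
Lemma scalar_flat phi :
  scalar_eq (fun _ => 0) (flat_metric A) (fun x => phi (radial x)).
Proof.
pose j r := - (expR (A r))^-1 * derive1 phi r.
have gradE (mu : 'I_3) : gradient (flat_metric A) (fun x => phi (radial x)) mu =
    fun y => (mu == inord 1)%:R * j (radial y).
  apply/funext => y; rewrite gradient_radial.
  rewrite /inv_metric inv_flat ?lt0r_neq0 ?expR_gt0//.
  move: mu; apply: ord3P; rewrite mx3E //= -val_eqE /= !inordK //=;
  by rewrite ?mul0r ?mul1r.
split=> [mu x|x].
  rewrite gradE; apply: (@derivable_radial mu (fun r => (mu == inord 1)%:R * j r)) => ->.
  (* The only component differentiated along r is the radial one, which is identically zero. *)
  rewrite -val_eqE /= inordK //=.
  rewrite (_ : (fun _ => _) = cst 0); first exact: derivable_cst.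
  by apply/funext => r; rewrite mul0r.
rewrite derive1_cst /laplacian /divergence big1// => mu _.
rewrite gradE (partial_radial mu (fun r => (mu == inord 1)%:R * j r)).
rewrite sum3 !gradE !christoffel_flat //.
have zE : (fun r => 0 * j r) = cst 0 by apply/funext => r; rewrite mul0r.
by move: mu; apply: ord3P; rewrite !inord3_eq0 -?val_eqE /= !inordK //=;
  rewrite ?zE ?derive1_cst; ring.
Qed.

(** The friction term 2 A' phi' comes from Gamma^t_{t rho} = Gamma^x_{x rho} = A'. *)
Lemma scalar_ads V phi : (forall r, derivable (derive1 phi) r 1) ->
  (forall r, derive1 (derive1 phi) r + 2 * derive1 A r * derive1 phi r = derive1 V (phi r)) ->
  scalar_eq V (ads_metric A) (fun x => phi (radial x)).
Proof.
move=> dphi phiE.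
have gradE (mu : 'I_3) : gradient (ads_metric A) (fun x => phi (radial x)) mu =
    fun y => (mu == inord 0)%:R * derive1 phi (radial y).
  apply/funext => y; rewrite gradient_radial.
  rewrite /inv_metric inv_ads ?lt0r_neq0 ?expR_gt0//.
  move: mu; apply: ord3P; rewrite mx3E //= -val_eqE /= !inordK //=;
  by rewrite ?mul0r ?mul1r.
split=> [mu x|x].
  rewrite gradE; apply: (@derivable_radial mu (fun r => (mu == inord 0)%:R * derive1 phi r)) => _.
  exact: derivableM.
rewrite -phiE /laplacian /divergence !sum3.
rewrite !gradE.
rewrite !(partial_radial _ (fun r => (_ == inord 0)%:R * derive1 phi r)).
rewrite !christoffel_ads // !inord3_eq0 -?val_eqE /= !inordK //=.
have -> : (fun r => 1 * derive1 phi r) = derive1 phi.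
  by apply/funext => r; rewrite mul1r.
by ring.
Qed.

End ProfileC2.
End RadialCurvature.

(** * AdS walls from the gradient flow of a polynomial superpotential *)

Section Superpotential.
Context {R : realType}.

Lemma is_derive_C0 (h : R -> R) (dh : R -> R) :
  (forall r : R, is_derive r 1 h (dh r)) -> continuous h.
Proof.
move=> hD r; apply: differentiable_continuous; apply/derivable1_diffP.
by case: (hD r).
Qed.

Definition potential_of (W : {poly R}) : {poly R} :=
  2 *: W^`() ^+ 2 - 2 *: W ^+ 2.

Lemma potential_ofE W y :
  (potential_of W).[y] = 2 * W^`().[y] ^+ 2 - 2 * W.[y] ^+ 2.
Proof. by rewrite /potential_of !(hornerD, hornerN, hornerZ, horner_exp). Qed.

Variables (W : {poly R}) (A phi : R -> R).
Hypothesis A_flow : forall r : R, is_derive r 1 A W.[phi r].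
Hypothesis phi_flow : forall r : R, is_derive r 1 phi (- 2 * W^`().[phi r]).

Let dA_flow : derive1 A = horner W \o phi.
Proof. by apply/funext => r; exact: derive1P. Qed.

Let dphi_flow : derive1 phi = horner (- 2 *: W^`()) \o phi.
Proof. by apply/funext => r; rewrite /= hornerZ; exact: derive1P. Qed.

Let comp_flow (P : {poly R}) (r : R) :
  is_derive r 1 (horner P \o phi) (P^`().[phi r] * (- 2 * W^`().[phi r])).
Proof. exact: is_derive1_comp (is_derive_poly P (phi r)) (phi_flow r). Qed.

Lemma superpotential_C2 : C2 A.
Proof.
split; first by move=> r; case: (A_flow r).
rewrite dA_flow; split=> [r|].
  by case: (comp_flow W r).
rewrite (_ : derive1 _ = horner (W^`() * (- 2 *: W^`())) \o phi).
  exact: is_derive_C0 (comp_flow _).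
by apply/funext => r; rewrite (derive1P (comp_flow W r)) /=
    !(hornerD, hornerN, hornerZ, hornerM, horner_exp).
Qed.

Lemma superpotential_C1 : C1 phi.
Proof.
split; first by move=> r; case: (phi_flow r).
rewrite dphi_flow; exact: is_derive_C0 (comp_flow _).
Qed.

(** Along the flow A'' = - 2 W'^2 = - phi'^2 / 2, and the choice of V makes the constraint read A'^2
    = W^2. Both sides of the scalar equation equal 4 W' W'' - 4 W W'. *)
Lemma superpotential_field_eqs :
  field_eqs (horner (potential_of W)) (ads_metric A) (fun x => phi (radial x)).
Proof.
split.
  apply/(einstein_ads superpotential_C2) => r.
  rewrite dphi_flow dA_flow (derive1P (comp_flow W r)) /potential_of /=
    !(hornerD, hornerN, hornerZ, hornerM, horner_exp).
  by split; field.
apply: (scalar_ads superpotential_C2) => r; rewrite dphi_flow.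
  by case: (comp_flow (- 2 *: W^`()) r).
rewrite (derive1P (comp_flow _ r)) (derive1P (is_derive_poly _ _)) dA_flow.
rewrite /potential_of /= !(derivB, derivD, derivZ, derivXn, derivC, deriv_exp)
  !(hornerD, hornerN, hornerZ, hornerM, horner_exp).
by ring.
Qed.

End Superpotential.

(** * An explicit kink wall interpolating between two AdS vacua *)

Section LogisticWall.
Context {R : realType}.

(* kinkW has critical points 0 and 1, with kinkW(0) = 1 and kinkW(1) = 13/12 =
   1 / l; the factor 1/2 in kinkW' makes the flow kink' = - kink (1 - kink). *)
Definition kinkW : {poly R} := 1 + 4^-1 *: 'X^2 - 6^-1 *: 'X^3.
Definition kink (r : R) : R := (1 + expR r)^-1.
(** A primitive of [kinkW] along [kink], found by taking k = [kink] as variable: r - ln (1 + e^r) is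
    ln (1 - k), and the rest comes from integrating - (k / 4 - k^2 / 6) / (1 - k). *)
Definition kinkA (r : R) : R :=
  r + 12^-1 * (r - ln (1 + expR r) + kink r - kink r ^+ 2).

Lemma onePexp_gt0 (r : R) : 0 < 1 + expR r.
Proof. by rewrite addr_gt0 ?expR_gt0. Qed.

Lemma kinkWE y : kinkW.[y] = 1 + 4^-1 * y ^+ 2 - 6^-1 * y ^+ 3.
Proof. by rewrite /kinkW !(hornerD, hornerN, hornerZ, hornerXn, hornerC). Qed.

Lemma kinkW'E y : kinkW^`().[y] = 2^-1 * (y - y ^+ 2).
Proof.
rewrite /kinkW !(derivB, derivD, derivZ, derivXn, derivC).
rewrite !(hornerD, hornerN, hornerZ, hornerMn, hornerXn, hornerC) /=; by field.
Qed.

Lemma kink_flow (r : R) : is_derive r 1 kink (- 2 * kinkW^`().[kink r]).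
Proof.
have d1 : is_derive r 1 (fun r => 1 + expR r) (0 + expR r).
  by apply: is_deriveD.
have e0 := lt0r_neq0 (onePexp_gt0 r).
apply: is_derive_eq (is_deriveV _ d1) _ => //.
rewrite kinkW'E /kink /GRing.scale /=. by field.
Qed.

Lemma kinkA_flow (r : R) : is_derive r 1 kinkA kinkW.[kink r].
Proof.
have d1 : is_derive r 1 (fun r => 1 + expR r) (0 + expR r).
  by apply: is_deriveD.
have e0 := onePexp_gt0 r.
have dl : is_derive r 1 (fun r => ln (1 + expR r)) ((1 + expR r)^-1 * (0 + expR r)).
  by apply: is_derive1_comp; exact: is_derive1_ln.
have dk := kink_flow r.
have dk2 : is_derive r 1 (fun r => kink r ^+ 2) (2 * kink r * (- 2 * kinkW^`().[kink r])).
  apply: is_derive_eq (is_deriveM dk dk) _; rewrite /GRing.scale /=; ring.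
have d := is_deriveD (is_derive_id r 1)
  (is_deriveZ 12^-1 (is_deriveB (is_deriveD (is_deriveB (is_derive_id r 1) dl) dk) dk2)).
apply: is_derive_eq d _.
rewrite kinkW'E kinkWE /GRing.scale /kink /=.
field. exact: lt0r_neq0.
Qed.

Lemma kink_potential : ads_potential (horner (potential_of kinkW)).
Proof.
split; first by move=> y; exact: derivable_horner.
have VE y : (potential_of kinkW).[y] = 2^-1 * (y - y ^+ 2) ^+ 2 
    - 2 * (1 + 4^-1 * y ^+ 2 - 6^-1 * y ^+ 3) ^+ 2.
  rewrite potential_ofE kinkW'E kinkWE.
  by field.
split; first by rewrite VE; field.
(* This is V''(0) = 4 W''(0)^2 - 4 W(0) W''(0) with W(0) = 1 and W''(0) = 1/2. *)
exists (- 1).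
(* [Q] is the remainder of V beyond second order, already divided by y^2; it vanishes at 0. *)
pose Q : {poly R} := - 3^-1 *: 'X + 2^-1 *: 'X^2 - 2 *: (4^-1 *: 'X - 6^-1 *: 'X^2) ^+ 2.
have QE y : Q.[y] = - 3^-1 * y + 2^-1 * y ^+ 2
    - 2 * (4^-1 * y - 6^-1 * y ^+ 2) ^+ 2.
  by rewrite /Q !(hornerD, hornerN, hornerZ, horner_exp, hornerXn, hornerX).
have Q0 : Q.[y] @[y --> 0^'] --> (0 : R).
  rewrite [X in _ --> X](_ : 0 = Q.[0]); last by rewrite QE; ring.
  exact/continuous_withinNx/continuous_horner.
apply: cvg_trans Q0; apply: near_eq_cvg.
near=> y.
have y0 : y != 0 by near: y; exact: nbhs_dnbhs_neq.
by rewrite VE QE; field.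
Unshelve. all: by end_near. Qed.

Lemma expRNy : expR r @[r --> -oo] --> (0 : R).
Proof. by apply/cvgNy_compNP; exact: cvgr_expR. Qed.

Lemma cvg_ln1 (F : set_system R) (FF : Filter F) (h : R -> R) :
  h r @[r --> F] --> 0 -> ln (1 + h r) @[r --> F] --> 0.
Proof.
move=> h0; rewrite -[X in _ --> X](@ln1 R).
apply: continuous_cvg; first exact: continuous_ln.
rewrite -[X in _ --> X](addr0 (1:R)); apply: cvgD => //; exact: cvg_cst.
Qed.

Lemma kink_cvgy : kink r @[r --> +oo] --> (0 : R).
Proof.
(* Towards +oo everything is rewritten in e^{-r}, which tends to 0. *)
have -> : kink = fun r => expR (- r) / (1 + expR (- r)).
  apply/funext => r; rewrite /kink expRN; field.
  by rewrite !lt0r_neq0 ?expR_gt0 ?onePexp_gt0// addrC onePexp_gt0.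
rewrite -[X in _ --> X](mul0r ((1 + 0)^-1 : R)).
apply: cvgM; first exact: cvgr_expR.
apply: cvgV; first by rewrite addr0 oner_neq0.
by apply: cvgD; [exact: cvg_cst | exact: cvgr_expR].
Qed.

Lemma kink_cvgNy : kink r @[r --> -oo] --> (1 : R).
Proof.
rewrite [X in _ --> X](_ : 1 = (1 + 0)^-1 :> R); last by rewrite addr0 invr1.
apply: cvgV; first by rewrite addr0 oner_neq0.
by apply: cvgD; [exact: cvg_cst | exact: expRNy].
Qed.

Lemma kinkA_cvgy : kinkA r - r @[r --> +oo] --> (0 : R).
Proof.
have -> : (fun r => kinkA r - r) =
    fun r => 12^-1 * (- ln (1 + expR (- r)) + kink r - kink r * kink r).
  apply/funext => r; rewrite /kinkA.
  (* Pulling e^r out of the logarithm cancels the linear growth of r - ln (1 + e^r). *)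
  have -> : 1 + expR r = expR r * (1 + expR (- r)).
    by rewrite expRN; field; rewrite lt0r_neq0 ?expR_gt0.
  rewrite lnM ?posrE ?expR_gt0 ?onePexp_gt0// expRK; by field.
rewrite [X in _ --> X](_ : 0 = 12^-1 * (- 0 + 0 - 0 * 0) :> R); last by field.
apply: cvgM; first exact: cvg_cst.
apply: cvgB; last by apply: cvgM; exact: kink_cvgy.
by apply: cvgD; [apply: cvgN; apply: cvg_ln1; exact: cvgr_expR | exact: kink_cvgy].
Qed.

Lemma kinkA_cvgNy : kinkA r - r / (12 / 13) @[r --> -oo] --> (0 : R).
Proof.
have -> : (fun r => kinkA r - r / (12 / 13)) =
    fun r => 12^-1 * (- ln (1 + expR r) + kink r - kink r * kink r).
  by apply/funext => r; rewrite /kinkA; field.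
(* Here [kink] tends to 1, so kink - kink^2 tends to 0. *)
rewrite [X in _ --> X](_ : 0 = 12^-1 * (- 0 + 1 - 1 * 1) :> R); last by field.
apply: cvgM; first exact: cvg_cst.
apply: cvgB; last by apply: cvgM; exact: kink_cvgNy.
by apply: cvgD; [apply: cvgN; apply: cvg_ln1; exact: expRNy | exact: kink_cvgNy].
Qed.

Lemma kink_wall : proper_ads_wall kinkA kink.
Proof.
split.
  exists (horner (potential_of kinkW)); split; first exact: kink_potential.
  exact: superpotential_field_eqs kinkA_flow kink_flow.
split; first by split; [exists 0; exact: kinkA_cvgy | exact: kink_cvgy].
split.
  exists (12 / 13); split; first by lra.
  by exists 0; exact: kinkA_cvgNy.
split; first by exists 1; exact: kink_cvgNy.
split; first exact: superpotential_C2 kinkA_flow kink_flow.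
exact: superpotential_C1 kink_flow.
Qed.
End LogisticWall.

(** * Transfer to flat space and comparison of the central charges *)

Theorem theorem1 (R : realType) (GN : R) (hGN : 0 < GN) :
  (forall A_AdS phi : R -> R, proper_ads_wall A_AdS phi ->
     exists A : R -> R,
       proper_flat_wall A phi /\
       exists cUV cIR : R,
         (asymptotic_bms3 GN +oo A 0 cUV /\ cUV = 3 / GN) /\
         (asymptotic_bms3 GN -oo A 0 cIR /\ cIR <> cUV)) /\
  (exists A_AdS phi : R -> R, proper_ads_wall A_AdS phi).
Proof.
(* The kink shows that the universal claim is not vacuous: unequal central charges do occur. *)
split; last by exists kinkA, kink; exact: kink_wall.
move=> A phi [[V [_ [EE _]]] [[[c Ac] phiy] [[l [/andP[l0 l1] [d Ad]]] [phiNy [A2 phi1]]]]].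
have orbUV : asymptotes_null_orbifold +oo A 1.
  split=> //; exists (- c).
  have -> : (fun r => A r - (r - - c) / 1) = fun r => A r - r - c.
    by apply/funext => r; field.
  by rewrite -(subrr c); apply: cvgB Ac _; exact: cvg_cst.
have orbIR : asymptotes_null_orbifold -oo A l.
  (* The shift solves (r - r0) / l = r / l + d. *)
  split=> //; exists (- (d * l)).
  have -> : (fun r => A r - (r - - (d * l)) / l) = fun r => A r - r / l - d.
    by apply/funext => r; field; rewrite lt0r_neq0.
  by rewrite -(subrr d); apply: cvgB Ad _; exact: cvg_cst.
exists A; split.
  split; last by do !split=> //; exists l.
  split; last exact: scalar_flat.
  (* Of the two AdS equations only the one for A'' passes to the flat side. *)
  move/(einstein_ads A2): EE => EE.
  by apply/(einstein_flat A2) => r; case: (EE r).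
exists (3 * 1 / GN), (3 * l / GN); split; split.
- by exists 1.
- by rewrite mulr1.
- by exists l.
(* Equal charges would force l = 1. *)
- move=> /(mulIf (invr_neq0 (lt0r_neq0 hGN))) ?; lra.
Qed.
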